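(* Let $p\in\{1,\dots,n\}$. A function $f\colon\mathbb{B}^n\to\mathbb{R}$ is $p$-locally monotone if and only if every $p$-ary section of $f$ is monotone.
   Context: $\mathbb{B}=\{0,1\}$, $[n]=\{1,\dots,n\}$. For $k\in[n]$, $\mathbf{x}\in\mathbb{B}^n$, $a\in\mathbb{B}$, $\mathbf{x}_k^a$ is the tuple obtained from $\mathbf{x}$ by replacing its $k$-th component by $a$; the partial derivative is $\Delta_kf(\mathbf{x})=f(\mathbf{x}_k^1)-f(\mathbf{x}_k^0)$. For $S\subseteq[n]$, $\mathbf{a}\in\mathbb{B}^n$, $\mathbf{x}\in\mathbb{B}^S$, $\mathbf{a}_S^{\mathbf{x}}$ is the tuple in $\mathbb{B}^n$ whose $i$-th component is $x_i$ if $i\in S$ and $a_i$ otherwise. An $S$-section of $f$ is a function $g\colon\mathbb{B}^S\to\mathbb{R}$ such that there is $\mathbf{a}\in\mathbb{B}^n$ with $g(\mathbf{x})=f(\mathbf{a}_S^{\mathbf{x}})$ for all $\mathbf{x}\in\mathbb{B}^S$; a $p$-ary section is an $S$-section with $|S|=p$. A function (of variables indexed by some finite set) is isotone (antitone) in a variable if its partial derivative in that variable is everywhere $\geq0$ ($\leq 0$), and it is monotone if in each variable it is isotone or antitone. The function $f$ is $p$-locally monotone if for every $k\in[n]$ and all $\mathbf{x},\mathbf{y}\in\mathbb{B}^n$ with $\sum_{i\in[n]\setminus\{k\}}|x_i-y_i|<p$ we have $\Delta_kf(\mathbf{x})\,\Delta_kf(\mathbf{y})\geq 0$. *)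

(* Defs.v *)
From HB Require Import structures.
From mathcomp Require Import all_boot all_order all_algebra.
From mathcomp Require Import reals.

Set Implicit Arguments.
Unset Strict Implicit.
Unset Printing Implicit Defensive.

Import Order.TTheory GRing.Theory Num.Theory.
Local Open Scope ring_scope.

(* Functions of Boolean variables are defined over an arbitrary finite index
   type I, since they are needed both for I = 'I_n and for I = a subset of 'I_n
   (the subtype {i | i \in S}). *)
Definition cube (I : finType) : Type := {ffun I -> bool}.

Definition replace (I : finType) (k : I) (x : cube I) (a : bool) : cube I :=
  [ffun i => if i == k then a else x i].

Definition pderiv (R : realType) (I : finType) (f : cube I -> R) (k : I)
    (x : cube I) : R :=
  f (replace k x true) - f (replace k x false).

Definition isotone_in (R : realType) (I : finType) (f : cube I -> R) (k : I) :
    Prop :=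
  forall x : cube I, 0 <= pderiv f k x.

Definition antitone_in (R : realType) (I : finType) (f : cube I -> R) (k : I) :
    Prop :=
  forall x : cube I, pderiv f k x <= 0.

Definition monotone (R : realType) (I : finType) (f : cube I -> R) : Prop :=
  forall k : I, isotone_in f k \/ antitone_in f k.

(* The tuple a_S^x; [insub i] is [Some] of i, seen in the subtype, exactly when
   i \in S, and [None] otherwise. *)
Definition override (I : finType) (S : {set I}) (a : cube I)
    (x : cube {i : I | i \in S}) : cube I :=
  [ffun i => if insub i is Some j then x j else a i].

Definition is_section (R : realType) (I : finType) (f : cube I -> R)
    (S : {set I}) (g : cube {i : I | i \in S} -> R) : Prop :=
  exists a : cube I, forall x : cube {i : I | i \in S}, g x = f (override a x).

Definition locally_monotone (R : realType) (I : finType) (p : nat)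
    (f : cube I -> R) : Prop :=
  forall (k : I) (x y : cube I),
    \sum_(i | i != k) `|(x i)%:R - (y i)%:R : R| < p%:R ->
    0 <= pderiv f k x * pderiv f k y.

(* Main.v *)
(** Both properties say that [pderiv f k] does not change sign between points
    that agree outside some p-element set S containing k. Indeed, the derivatives
    of the S-section of f at a are the derivatives of f at the points
    [override a x], and two points at distance less than p off k differ only
    inside such a set S. *)
Require Import Defs.
From HB Require Import structures.
From mathcomp Require Import all_boot all_order all_algebra.
From mathcomp Require Import reals.

Import Order.TTheory GRing.Theory Num.Theory.
Local Open Scope ring_scope.

(** The [p - #|A|] missing elements are drawn from the complement of [A], which is large enough
    because [p <= #|T|]. *)
Lemma ex_superset_card (T : finType) (A : {set T}) (p : nat) :
  (#|A| <= p <= #|T|)%N -> exists2 S : {set T}, A \subset S & #|S| = p.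
Proof.
case/andP=> leAp lepT.
have : (p - #|A| <= #|~: A|)%N by rewrite leq_subLR cardsC.
case/card_geqP=> s [s_uniq s_size sA].
exists (A :|: [set:: s]); first exact: subsetUl.
rewrite cardsU (_ : A :&: [set:: s] = set0); last first.
  apply/setP=> i; rewrite !inE; apply/negP=> /andP[iA /sA].
  by rewrite !inE iA.
by rewrite cards0 subn0 cardsE (card_uniqP s_uniq) s_size subnKC.
Qed.

(** Recasts the disjunction in the product form of [locally_monotone]. If the derivative is negative
    at one point, nonnegative products force it to be nonpositive everywhere. *)
Lemma isotone_or_antitoneP (R : realType) (I : finType) (f : cube I -> R) (k : I) :
  isotone_in f k \/ antitone_in f k <->
  forall x y, 0 <= pderiv f k x * pderiv f k y.
Proof.
split=> [[] fk x y|fk]; [exact: mulr_ge0 | exact: mulr_le0 |].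
have [/forallP|/forallPn[x]] := boolP [forall x : {ffun I -> bool}, 0 <= pderiv f k x].
  by left.
rewrite -ltNge => fx_lt0; right=> y.
by rewrite -(nmulr_rge0 _ fx_lt0).
Qed.

Section Cube.

Variables (R : realType) (I : finType).
Implicit Types (f : cube I -> R) (S : {set I}) (a x y : cube I) (k : I).

(** On Boolean tuples each term is 0 or 1, so the real bound in [locally_monotone] becomes a bound
    on a cardinality. *)
Lemma sum_dist_card (P : pred I) x y :
  \sum_(i | P i) `|(x i)%:R - (y i)%:R : R|
    = #|[set i | P i & x i != y i]|%:R.
Proof.
rewrite -sum1_card natr_sum [RHS]big_mkcond /= [LHS]big_mkcond /=.
apply: eq_bigr => i _; rewrite inE; case: (P i) => //=.
by case: (x i); case: (y i); rewrite ?subrr ?subr0 ?sub0r ?normrN ?normr0 ?normr1.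
Qed.

Lemma override_replace S a (z : cube {i : I | i \in S}) (k : {i : I | i \in S})
    (b : bool) :
  override a (replace k z b) = replace (val k) (override a z) b.
Proof.
apply/ffunP=> i; rewrite !ffunE; case: insubP => [j _ <-|iS].
  by rewrite ffunE (inj_eq val_inj).
by case: eqP => // ik; rewrite ik (valP k) in iS.
Qed.

Lemma override_restrict S a x :
  (forall i, i \notin S -> x i = a i) ->
  override a [ffun j : {i : I | i \in S} => x (val j)] = x.
Proof.
move=> xa; apply/ffunP=> i; rewrite ffunE.
by case: insubP => [j _ <-|/xa //]; rewrite ffunE.
Qed.

Lemma pderiv_section f S (g : cube {i : I | i \in S} -> R) a :
  (forall z, g z = f (override a z)) ->
  forall (k : {i : I | i \in S}) z,
    pderiv g k z = pderiv f (val k) (override a z).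
Proof. by move=> gE k z; rewrite /pderiv !gE !override_replace. Qed.

Lemma locally_monotone_section f p S (g : cube {i : I | i \in S} -> R) :
  locally_monotone p f -> #|S| = p -> is_section f g -> monotone g.
Proof.
move=> fp cardS [a gE] k; apply/isotone_or_antitoneP => x y.
rewrite !(pderiv_section _ _ _ _ gE); apply: fp.
(* Both points equal [a] outside [S], so off [k] they can differ only in [S] without [k]; dropping
   [k] from [S] makes the bound strict. *)
rewrite sum_dist_card ltr_nat -cardS (cardsD1 (val k) S) (valP k) ltnS.
apply/subset_leq_card/subsetP => i; rewrite !inE !ffunE => /andP[-> /=].
by case: insubP => // _; rewrite eqxx.
Qed.

Lemma sections_locally_monotone f p :
  (p <= #|I|)%N ->
  (forall S (g : cube {i : I | i \in S} -> R),
     #|S| = p -> is_section f g -> monotone g) ->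
  locally_monotone p f.
Proof.
move=> lepI fS k x y; rewrite sum_dist_card ltr_nat.
set D := [set i | _ & _] => ltDp.
(* Adjoining [k] to [D] costs at most one element, and [#|D| < p] leaves room for it. *)
have [|S /subsetP DS cardS] := ex_superset_card I (k |: D) p.
  rewrite lepI andbT (leq_trans _ ltDp) // cardsU1.
  by rewrite -add1n leq_add2r leq_b1.
have kS : k \in S by rewrite DS // setU11.
have xy i : i \notin S -> x i = y i.
  apply: contraNeq => xyi; apply: DS; rewrite !inE xyi andbT.
  exact: orbN.
(* One base point serves for both: since [x] agrees with [y] outside [S], overriding [y] by the
   restriction of [x] to [S] gives back [x]. *)
pose g (z : cube {i : I | i \in S}) := f (override y z).
have gE z : g z = f (override y z) by [].
have /isotone_or_antitoneP gk : isotone_in g (Sub k kS) \/ antitone_in g (Sub k kS).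
  by apply: fS cardS _ _; exists y.
have := gk [ffun j => x (val j)] [ffun j => y (val j)].
by rewrite !(pderiv_section _ _ _ _ gE) !override_restrict.
Qed.

End Cube.

Theorem theorem8 (R : realType) (n p : nat) (hp : (1 <= p <= n)%N)
    (f : cube 'I_n -> R) :
  locally_monotone p f <->
  (forall (S : {set 'I_n}) (g : cube {i : 'I_n | i \in S} -> R),
     #|S| = p -> is_section f g -> monotone g).
Proof.
split=> [fp S g|]; first exact: locally_monotone_section.
by apply: sections_locally_monotone; rewrite card_ord; case/andP: hp.
Qed.
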